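(* Let $n>k\ge1$ be relatively prime integers and let $N\in\mathrm{GL}(V)$ be the map $N(x_\alpha)=x_{-\alpha}$, $\alpha\in\mathbb{Z}_n$. For all $\tau\in\mathbb{C}$, $N$ extends to algebra isomorphisms $Q_{n,k}(E,\tau)\to Q_{n,k}(E,-\tau)$ and $Q_{n,k}(E,\tau)\to Q_{n,k}(E,\tau)^{\mathrm{op}}$. In particular, $$Q_{n,k}(E,\tau)\;\cong\;Q_{n,k}(E,\tau)^{\mathrm{op}}\;=\;Q_{n,k}(E,-\tau).$$
   Context: Notation: $e(z)=e^{2\pi i z}$; $\mathbb{Z}_n=\mathbb{Z}/n\mathbb{Z}$; $A^{\mathrm{op}}$ is the opposite algebra. Fix $\eta\in\mathbb{C}$ in the upper half-plane, $\Lambda=\mathbb{Z}+\mathbb{Z}\eta$, $E=\mathbb{C}/\Lambda$, and $E[n]=\frac1n\Lambda/\Lambda$. Let $\theta(z)=\sum_{m\in\mathbb{Z}}(-1)^m e\big(mz+\tfrac12 m(m-1)\eta\big)$ and, for $\alpha\in\mathbb{Z}$, $$\theta_\alpha(z)=e\Big(\alpha z+\tfrac{\alpha}{2n}+\tfrac{\alpha(\alpha-n)}{2n}\eta\Big)\prod_{m=0}^{n-1}\theta\Big(z+\tfrac mn+\tfrac{\alpha}{n}\eta\Big),$$ which depends only on $\alpha$ modulo $n$; the zeros of the $\theta_\alpha$'s lie in $\frac1n\Lambda$. Let $V$ be a $\mathbb{C}$-vector space with basis $\{x_i\mid i\in\mathbb{Z}_n\}$ and $TV=\mathbb{C}\langle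 x_0,\ldots,x_{n-1}\rangle$. For $\tau\in\mathbb{C}-\frac1n\Lambda$ and $i,j\in\mathbb{Z}_n$ let $$r_{ij}(\tau)=\sum_{r\in\mathbb{Z}_n}\frac{\theta_{j-i+(k-1)r}(0)}{\theta_{j-i-r}(-\tau)\,\theta_{kr}(\tau)}\;x_{j-r}\otimes x_{i+r}\in V\otimes V.$$ Up to a non-zero scalar, $r_{ij}(\tau)$ depends only on $\tau+\Lambda$. If $r_{ij}$ is not identically zero on $\mathbb{C}-\frac1n\Lambda$, then it is nowhere zero there, and $\tau\mapsto L_{ij}(\tau):=\mathbb{C}\cdot r_{ij}(\tau)$ is a morphism $E-E[n]\to\mathbb{P}(V\otimes V)$ (the projective space of $1$-dimensional subspaces) that extends uniquely to a morphism $L_{ij}:E\to\mathbb{P}(V\otimes V)$; for $\tau\in\mathbb{C}$, $L_{ij}(\tau)\subseteq V\otimes V$ denotes the line that is the image of $\tau+\Lambda$. For all $\tau\in\mathbb{C}$, $\mathrm{rel}_{n,k}(E,\tau)\subseteq V\otimes V$ is the linear span of these $L_{ij}(\tau)$'s (over all $(i,j)$ with $r_{ij}$ not identically zero), and $Q_{n,k}(E,\tau)=TV/(\mathrm{rel}_{n,k}(E,\tau))$. The equality $Q_{n,k}(E,\tau)^{\mathrm{op}}=Q_{n,k}(E,-\tau)$ means that the identity map on the generators $x_i$ extends to an algebra isomorphism. *)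

(* Defs.v *)
From HB Require Import structures.
From mathcomp Require Import all_boot all_order all_algebra finmap.
From mathcomp Require Import all_classical all_reals all_analysis.
From mathcomp Require Import complex.
(* The notations of monalg clash with those of MathComp-Analysis. *)
From mathcomp Require Import -(notations) monalg.

Set Implicit Arguments.
Unset Strict Implicit.
Unset Printing Implicit Defensive.

Import Order.TTheory GRing.Theory Num.Theory numFieldNormedType.Exports.

Local Open Scope ring_scope.
Local Open Scope quotient_scope.
Local Open Scope classical_set_scope.
Local Open Scope complex_scope.

(** * Free algebras, quotients by two-sided ideals, opposite algebras *)

Definition ideal_gen (A : nzRingType) (S : set A) : set A :=
  [set x | exists s : seq (A * A * A),
    (forall t, t \in s -> S t.1.2) /\ x = \sum_(t <- s) t.1.1 * t.1.2 * t.2].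

Definition freeAlg (F : comNzRingType) (I : choiceType) : Type :=
  malg (fmonom I) F.

Section FreeAlgebra.
Variables (F : comNzRingType) (I : choiceType).

HB.instance Definition _ := GRing.Lalgebra.on (freeAlg F I).

Fact freeAlg_scaleAr (c : F) (p q : freeAlg F I) :
  c *: (p * q) = p * (c *: q).
Proof.
apply/malgP => k; rewrite mcoeffZ mcoeffMl.
rewrite (mcoeffMlw k (fsubset_refl (msupp p)) (msuppZ_le c q)) mulr_sumr.
apply: eq_bigr => k1 _; rewrite mulr_sumr; apply: eq_bigr => k2 _.
by rewrite mcoeffZ mulrnAr mulrCA.
Qed.

HB.instance Definition _ :=
  GRing.Lalgebra_isAlgebra.Build F (freeAlg F I) freeAlg_scaleAr.

Definition fgen (i : I) : freeAlg F I := mkmalgU (fmu i) 1.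

(* The algebra morphism to F that sends all the generators to 0. *)
Definition faug (p : freeAlg F I) : F := mcoeff (fmone I) p.

Fact faug_zmod : zmod_morphism faug.
Proof. exact: (@raddfB _ _ (mcoeff (fmone I) : malg (fmonom I) F -> F)). Qed.

Fact faug_monoid : monoid_morphism faug.
Proof.
split; first exact: (@rmorph1 _ _ (mcoeff (mone : fmonom I) : malg _ F -> F)).
exact: (@rmorphM _ _ (mcoeff (mone : fmonom I) : malg _ F -> F)).
Qed.

HB.instance Definition _ :=
  GRing.isZmodMorphism.Build (freeAlg F I) F faug faug_zmod.
HB.instance Definition _ :=
  GRing.isMonoidMorphism.Build (freeAlg F I) F faug faug_monoid.

Fact faug_gen i : faug (fgen i) = 0.
Proof. by rewrite /faug /fgen mcoeffU fmP fmuE fmoneE. Qed.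

Fact faug_genZM c i p : faug (c *: (fgen i * p)) = 0.
Proof. by rewrite scalerAr rmorphM /= faug_gen mul0r. Qed.

Fact faug_ideal (S : set (freeAlg F I)) :
  (forall p, S p -> faug p = 0) -> ~ ideal_gen S 1.
Proof.
move=> S0 [s [sS /(congr1 faug)]].
rewrite rmorph1 big_seq raddf_sum big1 => [/eqP|t /sS/S0 t0].
  by rewrite oner_eq0.
by rewrite /= !rmorphM /= t0 mulr0 mul0r.
Qed.

End FreeAlgebra.

Record properIdeal (A : nzRingType) := ProperIdeal {
  ideal_set :> set A;
  _ : ideal_set 0;
  _ : forall x y, ideal_set x -> ideal_set y -> ideal_set (x - y);
  _ : forall a x b, ideal_set x -> ideal_set (a * x * b);
  _ : ~ ideal_set 1
}.

Section IdealGen.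
Variables (A : nzRingType) (S : set A).

Fact ideal_gen0 : ideal_gen S 0.
Proof. by exists [::]; rewrite big_nil. Qed.

Fact ideal_genB x y : ideal_gen S x -> ideal_gen S y -> ideal_gen S (x - y).
Proof.
move=> [s [sS ->]] [t [tS ->]].
exists (s ++ [seq (- u.1.1, u.1.2, u.2) | u <- t]); split=> [u|].
  by rewrite mem_cat => /orP[/sS//|/mapP[v /tS Sv ->]].
rewrite big_cat big_map -sumrN; congr (_ + _).
by apply: eq_bigr => u _; rewrite /= !mulNr.
Qed.

Fact ideal_genM a x b : ideal_gen S x -> ideal_gen S (a * x * b).
Proof.
move=> [s [sS ->]]; exists [seq (a * u.1.1, u.1.2, u.2 * b) | u <- s]; split.
  by move=> u /mapP[v /sS Sv ->].
rewrite big_map mulr_sumr mulr_suml.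
by apply: eq_bigr => u _; rewrite !mulrA.
Qed.

End IdealGen.

Section IdealPred.
Variables (A : nzRingType) (J : properIdeal A).

Definition ideal_pred : {pred A} := fun x => `[< ideal_set J x >].

Fact ideal_pred_zmod : zmod_closed ideal_pred.
Proof.
have [S0 SB] : ideal_set J 0 /\
  forall x y, ideal_set J x -> ideal_set J y -> ideal_set J (x - y) by case: J.
split=> [|x y]; rewrite !unfold_in; first exact/asboolP.
by move=> /asboolP Sx /asboolP Sy; apply/asboolP/SB.
Qed.

HB.instance Definition _ := GRing.isZmodClosed.Build A ideal_pred
  ideal_pred_zmod.

Fact ideal_predM a x b : x \in ideal_pred -> a * x * b \in ideal_pred.
Proof.
have SM : forall a x b, ideal_set J x -> ideal_set J (a * x * b) by case: J.
by rewrite !unfold_in => /asboolP Jx; apply/asboolP/SM.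
Qed.

Fact ideal_pred1 : 1 \notin ideal_pred.
Proof. by rewrite unfold_in; apply/asboolPn; case: J. Qed.

End IdealPred.

Definition quotAlg (F : comNzRingType) (A : algType F) (J : properIdeal A) :
  Type := {ideal_quot (ideal_pred J)}.

Section QuotientAlgebra.
Variables (F : comNzRingType) (A : algType F) (J : properIdeal A).
Local Notation Q := (quotAlg J).
Local Notation I := (ideal_pred J).

HB.instance Definition _ := GRing.Zmodule.on Q.

Definition quot_pi (a : A) : Q := \pi_({ideal_quot I}) a.
Definition quot_repr (x : Q) : A := repr (x : {ideal_quot I}).

Fact quot_piP a b : (quot_pi a == quot_pi b) = (a - b \in I).
Proof. exact/esym/Quotient.idealrBE. Qed.

Fact quot_reprK x : quot_pi (quot_repr x) = x.
Proof. exact: reprK. Qed.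

Fact quot_repr_pi a : quot_repr (quot_pi a) - a \in I.
Proof. by rewrite -quot_piP quot_reprK. Qed.

Fact quot_piD : {morph quot_pi : a b / a + b}.
Proof. exact: (@raddfD _ _ \pi_({ideal_quot I})). Qed.

Definition quot_one : Q := quot_pi 1.
Definition quot_mul (x y : Q) : Q := quot_pi (quot_repr x * quot_repr y).
Definition quot_scale (c : F) (x : Q) : Q := quot_pi (c *: quot_repr x).

Fact quot_piM a b : quot_mul (quot_pi a) (quot_pi b) = quot_pi (a * b).
Proof.
apply/eqP; rewrite quot_piP; set a' := quot_repr _; set b' := quot_repr _.
have ->: a' * b' - a * b = 1 * (a' - a) * b' + a * (b' - b) * 1.
  by rewrite mul1r mulr1 mulrBl mulrBr addrA subrK.
by apply: rpredD; apply: ideal_predM; apply: quot_repr_pi.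
Qed.

Fact quot_piZ c a : quot_scale c (quot_pi a) = quot_pi (c *: a).
Proof.
apply/eqP; rewrite quot_piP -scalerBr -[_ - _]mulr1 scalerAr -[_ * _]mul1r.
by rewrite mulrA; apply: ideal_predM; apply: quot_repr_pi.
Qed.

Fact quot_ind (P : Q -> Prop) : (forall a, P (quot_pi a)) -> forall x, P x.
Proof. by move=> Ppi x; rewrite -(quot_reprK x). Qed.

Fact quot_mulA : associative quot_mul.
Proof.
by elim/quot_ind => a; elim/quot_ind => b; elim/quot_ind => c;
  rewrite !quot_piM mulrA.
Qed.

Fact quot_mul1 : left_id quot_one quot_mul.
Proof. by elim/quot_ind => a; rewrite quot_piM mul1r. Qed.

Fact quot_1mul : right_id quot_one quot_mul.
Proof. by elim/quot_ind => a; rewrite quot_piM mulr1. Qed.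

Fact quot_mulDl : left_distributive quot_mul +%R.
Proof.
by elim/quot_ind => a; elim/quot_ind => b; elim/quot_ind => c;
  rewrite -quot_piD !quot_piM -quot_piD mulrDl.
Qed.

Fact quot_mulDr : right_distributive quot_mul +%R.
Proof.
by elim/quot_ind => a; elim/quot_ind => b; elim/quot_ind => c;
  rewrite -quot_piD !quot_piM -quot_piD mulrDr.
Qed.

Fact quot_one_neq0 : quot_one != 0.
Proof.
have -> : 0 = quot_pi 0 by apply: (addIr (quot_pi 0)); rewrite -quot_piD !add0r.
by rewrite quot_piP subr0 ideal_pred1.
Qed.

HB.instance Definition _ := GRing.Zmodule_isNzRing.Build Q
  quot_mulA quot_mul1 quot_1mul quot_mulDl quot_mulDr quot_one_neq0.

Fact quot_scaleA c d x : quot_scale c (quot_scale d x) = quot_scale (c * d) x.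
Proof. by elim/quot_ind: x => a; rewrite !quot_piZ scalerA. Qed.

Fact quot_scale1 : left_id 1 quot_scale.
Proof. by elim/quot_ind => a; rewrite quot_piZ scale1r. Qed.

Fact quot_scaleDr : right_distributive quot_scale +%R.
Proof.
by move=> c; elim/quot_ind => a; elim/quot_ind => b;
  rewrite -quot_piD !quot_piZ -quot_piD scalerDr.
Qed.

Fact quot_scaleDl x : {morph quot_scale^~ x : c d / c + d}.
Proof.
by move=> c d; elim/quot_ind: x => a; rewrite !quot_piZ -quot_piD scalerDl.
Qed.

HB.instance Definition _ := GRing.Zmodule_isLmodule.Build F Q
  quot_scaleA quot_scale1 quot_scaleDr quot_scaleDl.

Fact quot_scaleAl (c : F) (x y : Q) : c *: (x * y) = (c *: x) * y.
Proof.
elim/quot_ind: x => a; elim/quot_ind: y => b.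
rewrite /GRing.scale /= /GRing.mul /= quot_piM !quot_piZ quot_piM.
by rewrite scalerAl.
Qed.

HB.instance Definition _ := GRing.Lmodule_isLalgebra.Build F Q quot_scaleAl.

Fact quot_scaleAr (c : F) (x y : Q) : c *: (x * y) = x * (c *: y).
Proof.
elim/quot_ind: x => a; elim/quot_ind: y => b.
rewrite /GRing.scale /= /GRing.mul /= quot_piM !quot_piZ quot_piM.
by rewrite scalerAr.
Qed.

HB.instance Definition _ := GRing.Lalgebra_isAlgebra.Build F Q quot_scaleAr.

End QuotientAlgebra.

(* MathComp has the opposite ring A^c of a ring A, but not its structure of
   algebra when A is an algebra. *)
Section OppositeAlgebra.
Variables (F : comNzRingType) (A : algType F).

HB.instance Definition _ := GRing.Zmodule_isLmodule.Build F A^c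
  (@scalerA F A) (@scale1r F A) (@scalerDr F A) (fun v a b => scalerDl v a b).

Fact converse_scaleAl (c : F) (x y : A^c) : c *: (x * y) = (c *: x) * y.
Proof. exact: (@scalerAr F A c y x). Qed.

HB.instance Definition _ :=
  GRing.Lmodule_isLalgebra.Build F A^c converse_scaleAl.

Fact converse_scaleAr (c : F) (x y : A^c) : c *: (x * y) = x * (c *: y).
Proof. exact: (@scalerAl F A c y x). Qed.

HB.instance Definition _ :=
  GRing.Lalgebra_isAlgebra.Build F A^c converse_scaleAr.

End OppositeAlgebra.

Definition alg_iso (F : comNzRingType) (A B : algType F) : Prop :=
  exists f : {lrmorphism A -> B}, bijective f.

(* The map g : V -> V extends to an isomorphism of algebras A -> B, where A
   and B are generated by the images of V under iA and iB. *)
Definition extends_to_alg_iso (F : comNzRingType) (V : Type) (A B : algType F)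
    (iA : V -> A) (iB : V -> B) (g : V -> V) : Prop :=
  exists f : {lrmorphism A -> B}, bijective f /\ forall v, f (iA v) = iB (g v).

(** * Theta functions *)

Section Theta.
Variable R : realType.
Local Notation C := R[i].

Definition cexp (z : C) : C :=
  (expR (complex.Re z))%:C * (cos (complex.Im z) +i* sin (complex.Im z)).

Definition e2pi (z : C) : C := cexp ((0 +i* (2 * pi)) * z).

(* The sum of a two-sided series both halves of which converge *)
Definition int_series (u : int -> C) : C :=
  limn (fun N => \sum_(0 <= m < N) u (Posz m) : R[i]^o) +
  limn (fun N => \sum_(0 <= m < N) u (Negz m) : R[i]^o).

Definition theta (eta z : C) : C :=
  int_series (fun m => (-1) ^ m *
    e2pi (m%:~R * z + (m * (m - 1))%:~R / 2 * eta)).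

Definition theta_int (n : nat) (eta : C) (a : int) (z : C) : C :=
  e2pi (a%:~R * z + a%:~R / (2 * n%:R) +
        (a * (a - n%:Z))%:~R / (2 * n%:R) * eta) *
  \prod_(0 <= m < n) theta eta (z + m%:R / n%:R + a%:~R / n%:R * eta).

(* theta_int only depends on the class of a modulo n. 'Z_n is the ring of
   integers modulo n when n > 1. *)
Definition theta_ (n : nat) (eta : C) (a : 'Z_n) (z : C) : C :=
  theta_int n eta (a : nat)%:Z z.

(** * The elliptic curve E = C / Lambda *)

Definition lattice (eta : C) : {pred C} :=
  fun z => `[< exists a b : int, z = a%:~R + b%:~R * eta >].

Fact lattice_zmod eta : zmod_closed (lattice eta).
Proof.
split=> [|x y]; rewrite !unfold_in.
  by apply/asboolP; exists 0, 0; rewrite mul0r addr0.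
move=> /asboolP[a [b ->]] /asboolP[c [d ->]]; apply/asboolP.
exists (a - c), (b - d).
by rewrite !rmorphB mulrBl opprD !addrA; congr (_ + _); rewrite addrAC.
Qed.

HB.instance Definition _ eta :=
  GRing.isZmodClosed.Build C (lattice eta) (lattice_zmod eta).

Definition ecurve (eta : C) : zmodType := {ideal_quot (lattice eta)}.

Definition epi (eta z : C) : ecurve eta := \pi_({ideal_quot (lattice eta)}) z.

(* (1/n) Lambda *)
Definition div_lattice (n : nat) (eta : C) : set C :=
  [set z | exists2 w, w \in lattice eta & z = w / n%:R].

(* Morphisms from E to the projective space of lines in a space of matrices:
   locally, such a map is the line spanned by a nowhere zero holomorphic
   function.  As E is a compact Riemann surface, the holomorphic maps to a
   projective space are the morphisms of algebraic varieties. *)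
Definition proj_morphism (eta : C) (p q : nat)
    (L : ecurve eta -> {vspace 'M[C]_(p, q)}) : Prop :=
  forall z0 : C, exists f : C -> 'M[C]_(p, q),
    \forall z \near (z0 : R[i]^o),
      [/\ f z != 0,
          forall a b, derivable (fun w : R[i]^o => f w a b : R[i]^o) z 1 &
          L (epi eta z) = <[f z]>%VS].

(** * The algebras Q_{n,k}(E, tau) *)

Section Qnk.
Variables (n k : nat) (eta : C).

(* The row vectors indexed by 'Z_n *)
Definition Vn := 'rV[C]_((Zp_trunc n).+2).

Definition x_ (a : 'Z_n) : Vn := delta_mx 0 a.

(* V (x) V is identified with the space of square matrices indexed by 'Z_n,
   so that x_a (x) x_b is the elementary matrix with index (a, b). *)
Definition VV := 'M[C]_((Zp_trunc n).+2).

Definition tens (u v : Vn) : VV := u^T *m v.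

Definition Nmap (v : Vn) : Vn := \sum_(a : 'Z_n) v 0 a *: x_ (- a).

Fact Nmap_linear : linear Nmap.
Proof.
move=> c u v; rewrite /Nmap scaler_sumr -big_split; apply: eq_bigr => a _.
by rewrite !mxE scalerDl scalerA.
Qed.

HB.instance Definition _ := GRing.isLinear.Build C Vn Vn _ Nmap Nmap_linear.

Fact Nmap_x (a : 'Z_n) : Nmap (x_ a) = x_ (- a).
Proof.
rewrite /Nmap (bigD1 a) //= big1 => [|b /negbTE nba].
  by rewrite mxE !eqxx scale1r addr0.
by rewrite mxE nba andbF scale0r.
Qed.

Fact NmapK : involutive Nmap.
Proof.
move=> v; rewrite {2}/Nmap linear_sum /= [RHS]row_sum_delta.
by apply: eq_bigr => a _; rewrite linearZ /= Nmap_x opprK.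
Qed.

Local Notation TV := (freeAlg C 'Z_n).

Definition TV1 (v : Vn) : TV := \sum_(a : 'Z_n) v 0 a *: fgen C a.

Definition TV2 (w : VV) : TV :=
  \sum_(a : 'Z_n) \sum_(b : 'Z_n) w a b *: (fgen C a * fgen C b).

Fact TV2_tens u v : TV2 (tens u v) = TV1 u * TV1 v.
Proof.
rewrite /TV1 mulr_suml; apply: eq_bigr => a _; rewrite mulr_sumr.
apply: eq_bigr => b _; rewrite -scalerAl -scalerAr scalerA mxE.
by rewrite big_ord1 mxE.
Qed.

Definition r_ (i j : 'Z_n) (tau : C) : VV :=
  \sum_(r : 'Z_n)
    (theta_ eta (j - i + (k%:R - 1) * r) 0 /
     (theta_ eta (j - i - r) (- tau) * theta_ eta (k%:R * r) tau))
    *: tens (x_ (j - r)) (x_ (i + r)).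

Definition r_nonzero (i j : 'Z_n) : Prop :=
  exists tau : C, ~ div_lattice n eta tau /\ r_ i j tau != 0.

Definition extends_r (i j : 'Z_n) (L : ecurve eta -> {vspace VV}) : Prop :=
  proj_morphism L /\
  forall tau : C, ~ div_lattice n eta tau -> L (epi eta tau) = <[r_ i j tau]>%VS.

(* The unique morphism that extends the lines spanned by r_ i j, which exists
   as soon as r_nonzero i j; only used in that case. *)
Definition L_ (i j : 'Z_n) : ecurve eta -> {vspace VV} :=
  xget (fun=> 0%VS) [set L | extends_r i j L].

Definition rel_nk (tau : C) : {vspace VV} :=
  (\sum_(i : 'Z_n) \sum_(j : 'Z_n | `[< r_nonzero i j >])
    L_ i j (epi eta tau))%VS.

Definition rel_ideal_set (tau : C) : set TV :=
  ideal_gen (TV2 @` [set w | w \in rel_nk tau]).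

Fact rel_ideal_proper tau : ~ rel_ideal_set tau 1.
Proof.
apply: faug_ideal => _ [w _ <-].
rewrite raddf_sum big1 // => a _; rewrite raddf_sum big1 // => b _.
exact: faug_genZM.
Qed.

Definition rel_ideal (tau : C) : properIdeal TV :=
  @ProperIdeal TV (rel_ideal_set tau) (ideal_gen0 _)
    (@ideal_genB _ _) (@ideal_genM _ _) (@rel_ideal_proper tau).

Definition Qalg (tau : C) : algType C := quotAlg (rel_ideal tau).

Definition Qgen (tau : C) (v : Vn) : Qalg tau :=
  quot_pi (rel_ideal tau) (TV1 v).

End Qnk.
End Theta.

Arguments Nmap {R} n v.
Arguments Qalg {R} n k eta tau.
Arguments Qgen {R} n k eta tau v.

(* Main.v *)
Require Import Defs.
From HB Require Import structures.
From mathcomp Require Import all_boot all_order all_algebra finmap.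
From mathcomp Require Import all_classical all_reals all_analysis.
From mathcomp Require Import complex.
From mathcomp Require Import -(notations) monalg.
From mathcomp Require Import ring lra zify.

(** Write d = j - i.  The coefficient of x_(j-r) (x) x_(i+r) in r_ij(tau) is
      c(d, r, tau) =
        theta_(d+(k-1)r)(0) / (theta_(d-r)(-tau) theta_(kr)(tau)),
    and everything rests on the single identity
      c(-d, -r, -tau) = - c(d, r, tau)                     (r_coefN).
    It comes from the reflection formula (theta_N)
      theta_(-a)(z) = - e(nz) e(-a/n) theta_a(-z).
    In the quotient, the factors e(-a/n) cancel since a |-> e(a/n) is a
    character of Z_n and (d - r) + kr = d + (k-1)r; the factors e(nz) cancel
    since they are 1 in the numerator, and e(n tau) and e(-n tau) in the
    denominator; and three signs remain.  The reflection formula itself follows,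
    factor by factor, from theta(z+1) = theta(z), which holds term by term, and
    from theta(z+eta) = - e(-z) theta(z) and theta(-z) = - e(-z) theta(z), which
    are reindexings of the theta series and rely on its convergence, hence on
    Im eta > 0.

    Reindexing r to -r turns the identity into two symmetries of the relations:
    both the map N (x) N and the flip u (x) v |-> v (x) u send r_ij(tau) to the
    opposite of a relation at -tau, namely r_(-i,-j)(-tau) and r_ji(-tau).
    Each of the two maps permutes the entries of a matrix by an involution s of
    the pairs of indices, and in both cases the resulting relation is the one
    of index s(i,j); the two cases are therefore treated together.

    At the points of E[n] the lines L_ij are only known as values of the
    extended morphism.  They inherit the symmetry because the extension is
    unique (proj_morphism_eq): two morphisms that agree off the n-torsion agree
    by continuity of the 2x2 minors.  Conjugating the extension of the lines
    r_ij by s and by tau |-> -tau gives an extension of the lines r_s(i,j), so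
    N (x) N and the flip map rel(tau) into rel(-tau) for every tau
    (rel_nk_sym).

    By the universal property of TV / (rel), N thus induces a morphism
    Q(tau) -> Q(-tau), and the identity of V a morphism Q(tau) -> Q(-tau)^op.
    The morphisms obtained in the same way from -tau are inverse to them, since
    they are on generators.  Composing the two isomorphisms gives
    Q(tau) -> Q(tau)^op. *)

Set Implicit Arguments.
Unset Strict Implicit.
Unset Printing Implicit Defensive.

Import Order.TTheory GRing.Theory Num.Theory numFieldNormedType.Exports.
Import ComplexField.Normc.

Local Open Scope ring_scope.

(** * The exponential and two-sided series *)

Section Exponential.
Variable R : realType.
Local Notation C := R[i].
Implicit Types z w : C.

Lemma e2piD z w : e2pi (z + w) = e2pi z * e2pi w.
Proof.
have cexpD (u v : C) : cexp (u + v) = cexp u * cexp v.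
  case: u v => [a b] [c d]; rewrite /cexp /= expRD cosD sinD.
  by apply/eqP; rewrite eq_complex /=; apply/andP; split; apply/eqP; ring.
by rewrite /e2pi mulrDr cexpD.
Qed.

Lemma e2pi0 : e2pi (0 : C) = 1.
Proof.
rewrite /e2pi mulr0 /cexp /= expR0 cos0 sin0.
by apply/eqP; rewrite eq_complex /=; apply/andP; split; apply/eqP; ring.
Qed.

Lemma e2pi_half : e2pi (1 / 2 : C) = -1.
Proof.
have -> : (1 / 2 : C) = (1 / 2 : R)%:C%C.
  by rewrite rmorphM rmorph1 fmorphV rmorph_nat.
rewrite /e2pi /cexp /= !(mul0r, mulr0, subr0, oppr0, addr0, add0r) expR0.
have -> : 2 * pi * (1 / 2) = pi :> R by field.
rewrite cospi sinpi; apply/eqP; rewrite eq_complex /=.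
by apply/andP; split; apply/eqP; ring.
Qed.

Lemma e2pi_halfD z : e2pi (z + 1 / 2) = - e2pi z.
Proof. by rewrite e2piD e2pi_half mulrN1. Qed.

Lemma e2piD1 z : e2pi (z + 1) = e2pi z.
Proof.
have -> : z + 1 = z + 1 / 2 + 1 / 2 by field.
by rewrite !e2pi_halfD opprK.
Qed.

Lemma e2pi_neq0 z : e2pi z != 0.
Proof.
apply/eqP => z0; have /eqP := e2piD z (- z).
by rewrite subrr e2pi0 z0 mul0r oner_eq0.
Qed.

Lemma e2piN z : e2pi (- z) = (e2pi z)^-1.
Proof.
apply: (mulfI (e2pi_neq0 z)); rewrite -e2piD subrr e2pi0 divff //.
exact: e2pi_neq0.
Qed.

Lemma e2piDn z (m : nat) : e2pi (z + m%:R) = e2pi z.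
Proof.
elim: m => [|m IHm]; first by rewrite addr0.
by rewrite -natr1 addrA e2piD1.
Qed.

Lemma e2piDz z (m : int) : e2pi (z + m%:~R) = e2pi z.
Proof.
case: m => m; first exact: e2piDn.
by rewrite NegzE rmorphN -(e2piDn (_ - _) m.+1) subrK.
Qed.

Lemma normc_e2pi z : normc (e2pi z) = expR (- (2 * pi * complex.Im z)).
Proof.
rewrite /e2pi /cexp normcM /= cos2Dsin2 sqrtr1 mulr1 expr0n addr0 sqrtr_sqr.
rewrite gtr0_norm ?expR_gt0 //; case: z => a b /=; congr expR; ring.
Qed.

End Exponential.

Section TwoSidedSeries.
Local Open Scope classical_set_scope.
Variable R : realType.
Local Notation C := R[i].
Implicit Types (s : nat -> C) (u : int -> C).

Lemma cvgn_complex s :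
  cvgn (@complex.Re R \o s) -> cvgn (@complex.Im R \o s) ->
  cvgn (s : nat -> C^o).
Proof.
move=> /cvg_ex[/= a sa] /cvg_ex[/= b sb]; apply/cvg_ex.
exists ((a%:C + 'i * b%:C)%C : C^o).
have cR (f : nat -> R) (l : R) : f @ \oo --> l ->
    (fun m => (f m)%:C%C : C^o) @ \oo --> (l%:C%C : C^o).
  move=> /cvgrPdist_lt fl; apply/cvgrPdist_lt => e e0.
  have er : e = (complex.Re e)%:C%C by rewrite RRe_real // gtr0_real.
  have e0' : 0 < complex.Re e by rewrite -ltcR -er.
  near=> m; rewrite -rmorphB normc_def /= expr0n addr0 sqrtr_sqr er ltcR.
  by near: m; exact: fl.
have -> : (s : nat -> C^o) =
    (fun m => (complex.Re (s m))%:C%C + 'i%C * (complex.Im (s m))%:C%C : C^o).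
  by apply/funext => m; exact: complexE.
apply: (@cvgD C C^o _ \oo _ (fun m => (complex.Re (s m))%:C%C)
  (fun m => 'i%C * (complex.Im (s m))%:C%C) (a%:C)%C ('i * b%:C)%C).
  exact: cR sa.
exact: (@cvgZl_tmp C C^o _ _ _ _ (fun m => (complex.Im (s m))%:C%C) _
  (cR _ _ sb)).
Unshelve. all: by end_near. Qed.

Lemma cvgn_series_geometric s (A q : R) : 0 <= q < 1 ->
  (forall m, normc (s m) <= A * q ^+ m) ->
  cvgn ((fun N => \sum_(0 <= m < N) s m) : nat -> C^o).
Proof.
move=> /andP[q0 q1] sA.
have cR (f : nat -> R) : (forall m, `|f m| <= normc (s m)) -> cvgn (series f).
  move=> fs; apply: normed_cvg; apply: (@series_le_cvg _ _ (geometric A q)).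
  - by move=> m; exact: normr_ge0.
  - by move=> m; apply: le_trans (sA m); apply: le_trans (fs m).
  - by move=> m; apply: le_trans (sA m); apply: fs.
  - by apply: is_cvg_geometric_series; rewrite ger0_norm.
have big_Re N : complex.Re (\sum_(0 <= m < N) s m) =
    \sum_(0 <= m < N) complex.Re (s m).
  exact: (raddf_sum (@complex.Re R : Rcomplex R -> R)).
have big_Im N : complex.Im (\sum_(0 <= m < N) s m) =
    \sum_(0 <= m < N) complex.Im (s m).
  exact: (raddf_sum (@complex.Im R : Rcomplex R -> R)).
apply: cvgn_complex.
- rewrite (_ : _ \o _ = series (@complex.Re R \o s)); last first.
    by apply/funext => N; exact: big_Re.
  apply: cR => m /=; case: (s m) => a b /=.
  by rewrite -(sqrtr_sqr a) ler_wsqrtr // lerDl sqr_ge0.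
- rewrite (_ : _ \o _ = series (@complex.Im R \o s)); last first.
    by apply/funext => N; exact: big_Im.
  apply: cR => m /=; case: (s m) => a b /=.
  by rewrite -(sqrtr_sqr b) ler_wsqrtr // lerDr sqr_ge0.
Qed.

Lemma eq_limn (f g : nat -> C^o) : f =1 g -> limn f = limn g.
Proof. by move=> /funext ->. Qed.

Lemma limnE (f : nat -> C^o) (l : C^o) : f @ \oo --> l -> limn f = l.
Proof.
by move=> fl; apply: (@cvg_lim C^o); [exact: norm_hausdorff|exact: fl].
Qed.

Lemma limn_mull c (f : nat -> C^o) : cvgn f ->
  limn ((fun N => c * f N) : nat -> C^o) = c * limn f.
Proof.
move=> cf; apply: limnE.
exact: (@cvgZl_tmp C C^o nat \oo _ c f (limn f) cf).
Qed.

Lemma cvgn_addl c (f : nat -> C^o) (l : C^o) : f @ \oo --> l ->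
  ((fun N => c + f N) : nat -> C^o) @ \oo --> (c + l : C^o).
Proof. by move=> fl; exact: (@cvgD C C^o nat \oo _ _ f c l (cvg_cst _) fl). Qed.

Lemma cvgn_shift (f : nat -> C^o) (l : C^o) :
  ((fun N => f N.+1) @ \oo --> l) = (f @ \oo --> l).
Proof. by rewrite (cvg_shiftS f). Qed.

Definition int_summable u :=
  cvgn ((fun N => \sum_(0 <= m < N) u (Posz m)) : nat -> C^o) /\
  cvgn ((fun N => \sum_(0 <= m < N) u (Negz m)) : nat -> C^o).

Lemma eq_int_series (u v : int -> C) : u =1 v -> int_series u = int_series v.
Proof. by move=> /funext ->. Qed.

(** The involution m |-> -1 - m exchanges the indices Posz m and Negz m, hence
    the two halves of the sum; this needs no convergence. *)
Lemma int_series_reflect u : int_series (fun m => u (-1 - m)) = int_series u.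
Proof.
rewrite /int_series addrC; congr (_ + _); apply: eq_limn => N;
  by apply: eq_bigr => m _; congr u; lia.
Qed.

Lemma int_seriesZ c u : int_summable u ->
  int_series (fun m => c * u m) = c * int_series u.
Proof.
move=> [uP uN]; rewrite /int_series mulrDr -!limn_mull //.
by congr (_ + _); apply: eq_limn => N; rewrite mulr_sumr.
Qed.

(** The shift moves the term u 0 from one half of the sum to the other; the
    two corrections to the limits cancel, provided that both halves converge. *)
Lemma int_series_shift u : int_summable u ->
  int_series (fun m => u (m + 1)) = int_series u.
Proof.
move=> [uP uN]; rewrite /int_series.
set P := (fun N => _ : C^o) in uP; set M := (fun N => _ : C^o) in uN.
have cP : (fun N => \sum_(0 <= m < N) u (Posz m + 1) : C^o) @ \oo -->
    (- u 0 + limn P : C^o).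
  have -> : (fun N => \sum_(0 <= m < N) u (Posz m + 1) : C^o) =
      (fun N => - u 0 + P N.+1 : C^o).
    apply/funext => N; rewrite /P big_nat_recl // addKr.
    by apply: eq_bigr => m _; congr u; lia.
  apply: (@cvgn_addl _ (fun N => P N.+1)); rewrite cvgn_shift; exact: uP.
have cM : (fun N => \sum_(0 <= m < N) u (Negz m + 1) : C^o) @ \oo -->
    (u 0 + limn M : C^o).
  rewrite -cvgn_shift.
  have -> : (fun N => \sum_(0 <= m < N.+1) u (Negz m + 1) : C^o) =
      (fun N => u 0 + M N : C^o).
    apply/funext => N; rewrite big_nat_recl //; congr (_ + _).
    by apply: eq_bigr => m _; congr u; lia.
  exact: cvgn_addl uN.
by rewrite (limnE cP) (limnE cM) addrACA addNr add0r.
Qed.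

End TwoSidedSeries.

(** * Functional equations of theta *)

Section ThetaFunction.
Variable R : realType.
Local Notation C := R[i].
Variable eta : C.
Hypothesis eta_gt0 : 0 < complex.Im eta.
Implicit Types z : C.

Definition theta_term z (m : int) : C :=
  (-1) ^ m * e2pi (m%:~R * z + (m * (m - 1))%:~R / 2 * eta).

(** The modulus is the exponential of a quadratic polynomial in m whose leading
    coefficient - pi Im eta is negative, so it is dominated by e^(-|m|) times a
    constant, obtained by completing a square. *)
Lemma normc_theta_term z : exists2 K : R, 0 <= K &
  forall m : int, normc (theta_term z m) <= K * expR (-1) ^+ `|m|.
Proof.
pose a := pi * complex.Im eta; pose b := a - 2 * pi * complex.Im z.
have a0 : 0 < a by apply: mulr_gt0 => //; exact: pi_gt0.
exists (expR ((`|b| + 1) ^+ 2 / (4 * a))) => [|m]; first exact: expR_ge0.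
rewrite -expRM_natl -expRD /theta_term normcM.
have -> : normc ((-1) ^ m) = 1 :> R.
  have signE (p : nat) : normc ((-1) ^+ p) = 1 :> R.
    elim: p => [|p IHp]; first by rewrite expr0 normc1.
    by rewrite exprS normcM IHp mulr1 /= oppr0 expr0n addr0 sqrrN expr1n sqrtr1.
  case: m => p; first exact: signE.
  by rewrite [_ ^ _]/(((-1) ^+ p.+1)^-1) normcV signE invr1.
rewrite mul1r normc_e2pi ler_expR.
set x : R := m%:~R.
have -> : - (2 * pi * complex.Im (m%:~R * z + (m * (m - 1))%:~R / 2 * eta))
   = b * x - a * x ^+ 2.
  have -> : (m%:~R : C) = x%:C%C by rewrite rmorph_int.
  have -> : ((m * (m - 1))%:~R / 2 : C) = (x * (x - 1) / 2)%:C%C.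
    rewrite 3!rmorphM fmorphV !rmorphB rmorph1 /= !rmorph_int rmorph1.
    by rewrite rmorph_nat.
  rewrite /b /a; case: (z) => p q; case: (eta) => e h /=.
  by field.
have x_abs : (`|m|%N%:R : R) = `|x| by rewrite -intr_norm -natr_absz.
rewrite x_abs mulrN1 -lerBlDr opprK ler_pdivlMr; last first.
  by apply: mulr_gt0 => //; rewrite ltr0n.
have bx : b * x <= `|b| * `|x| by rewrite -normrM ler_norm.
have x2 : x ^+ 2 = `|x| ^+ 2 by rewrite real_normK // num_real.
rewrite x2; set y := `|x| in bx *; set c := `|b| in bx *.
(* The square that is completed in (c + 1) y - a y^2. *)
have : 0 <= (c + 1 - 2 * a * y) ^+ 2 by exact: sqr_ge0.
by nra.
Qed.

Lemma summable_theta_term z : int_summable (theta_term z).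
Proof.
have [K K0 zK] := normc_theta_term z.
have q1 : 0 <= (expR (-1) : R) < 1 by rewrite expR_ge0 expR_lt1 ltrN10.
split; [apply: (@cvgn_series_geometric R _ K (expR (-1)) q1) => m; exact: zK|].
apply: (@cvgn_series_geometric R _ K (expR (-1)) q1) => m.
apply: le_trans (zK _) _; rewrite NegzE abszN exprS ler_wpM2l //.
by rewrite -[leRHS]mul1r ler_wpM2r ?exprn_ge0.
Qed.

Lemma thetaE z : theta eta z = int_series (theta_term z).
Proof. by []. Qed.

Lemma thetaD1 z : theta eta (z + 1) = theta eta z.
Proof. by apply: eq_int_series => m; rewrite mulrDr mulr1 addrAC e2piDz. Qed.

(** The substitution m |-> m + 1 in the series of theta z. *)
Lemma thetaDeta z : theta eta (z + eta) = - e2pi (- z) * theta eta z.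
Proof.
suff -> : theta eta z = - e2pi z * theta eta (z + eta).
  by rewrite mulrA mulrNN -e2piD addNr e2pi0 mul1r.
rewrite thetaE -int_series_shift; last exact: summable_theta_term.
rewrite thetaE -int_seriesZ; last exact: summable_theta_term.
apply: eq_int_series => m; rewrite /theta_term exprzDr ?unitrN1 // expr1z.
rewrite mulrN1 !mulNr; congr (- _).
rewrite [RHS]mulrCA -e2piD; congr (_ * e2pi _).
by rewrite addrK !rmorphM !rmorphB !rmorphD rmorph1 /=; field.
Qed.

Lemma thetaN z : theta eta (- z) = - e2pi (- z) * theta eta z.
Proof.
have e2 : theta eta (z + eta + eta) = e2pi (- (2 * z + eta)) * theta eta z.
  by rewrite !thetaDeta mulrA mulrNN -e2piD; congr (e2pi _ * _); ring.
rewrite thetaE -int_series_reflect.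
(* The substitution m |-> 1 - m would give theta z; m |-> -1 - m lies two
   shifts away from it and gives theta (z + 2 eta). *)
have -> : - e2pi (- z) * theta eta z =
    - e2pi (z + eta) * theta eta (z + eta + eta).
  by rewrite e2 mulrA !mulNr -e2piD; congr (- (e2pi _ * _)); ring.
rewrite thetaE -int_seriesZ; last exact: summable_theta_term.
apply: eq_int_series => m; rewrite /theta_term exprzDr ?unitrN1 // exprN1.
rewrite -exprz_inv invrN1 mulN1r [RHS]mulrCA !mulNr -e2piD !mulrN.
congr (- (_ * e2pi _)).
by rewrite !rmorphM !rmorphB rmorphN rmorph1 /=; field.
Qed.

End ThetaFunction.

(** * The functions theta_a and their reflection formula *)

Section ThetaBasis.
Variable R : realType.
Local Notation C := R[i].
Variable eta : C.
Hypothesis eta_gt0 : 0 < complex.Im eta.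
Variable n : nat.
Hypothesis n_gt0 : (0 < n)%N.
Implicit Types z w : C.

Let nC_neq0 : n%:R != 0 :> C.
Proof. by rewrite pnatr_eq0 -lt0n. Qed.

Lemma prod_e2pi_arith (c d : C) (p : nat) :
  \prod_(0 <= m < p) e2pi (c + m%:R * d) =
  e2pi (p%:R * c + (p%:R * (p%:R - 1)) / 2 * d).
Proof.
elim: p => [|p IHp]; first by rewrite big_geq // !mul0r addr0 e2pi0.
by rewrite big_nat_recr //= IHp -e2piD -natr1; congr e2pi; field.
Qed.

(** The product of the factors by which the theta's of theta_int are multiplied
    under w |-> w + eta or w |-> -w.  Each sign is an e(1/2), so the n signs
    contribute e(n/2) and the terms m/n contribute e(-(n-1)/2): one sign is
    left. *)
Lemma prod_theta_factor w :
  \prod_(0 <= m < n) (- e2pi (- (w + m%:R / n%:R))) = - e2pi (- (n%:R * w)).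
Proof.
under eq_bigr => m _.
  rewrite -e2pi_halfD.
  rewrite (_ : _ + 1 / 2 = 1 / 2 - w + m%:R * - n%:R^-1); last by field.
  over.
by rewrite prod_e2pi_arith -e2pi_halfD; congr e2pi; field.
Qed.

(** Modulo 1, the numbers m/n form a subgroup, which is stable by opposite. *)
Lemma prod_periodic_opp (f : C -> C) : (forall x, f (x + 1) = f x) ->
  \prod_(0 <= m < n) f (m%:R / n%:R) = \prod_(0 <= m < n) f (- (m%:R / n%:R)).
Proof.
move=> f1; case: (n) n_gt0 nC_neq0 => // p _ p0.
rewrite !big_nat_recl //= mul0r oppr0; congr (_ * _).
rewrite [RHS]big_nat_rev; apply: eq_big_nat => m /= ltmp.
rewrite add0n subnSK // natrB; last exact: ltnW.
by rewrite -[RHS]f1; congr f; rewrite -!natr1 in p0 *; field.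
Qed.

(** Each of the n factors is translated by eta; the product of the n multipliers
    compensates the change of the exponential prefactor. *)
Lemma theta_intD (a : int) z :
  theta_int n eta (a + n%:Z) z = theta_int n eta a z.
Proof.
rewrite /theta_int.
under eq_bigr => m _.
  have -> : z + m%:R / n%:R + (a + n%:Z)%:~R / n%:R * eta =
      z + m%:R / n%:R + a%:~R / n%:R * eta + eta.
    by rewrite rmorphD /= -pmulrn; field.
  rewrite thetaDeta // (addrAC z).
  over.
rewrite big_split /= prod_theta_factor (mulrA _ _ (\prod_(_ <= _ < _) _)).
congr (_ * _).
  rewrite mulrN -e2piD -e2pi_halfD -[RHS]e2piD1; congr e2pi.
  by rewrite !rmorphM !rmorphB !rmorphD /= -!pmulrn; field.
by apply: eq_bigr => m _; rewrite (addrAC z).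
Qed.

(** The product over m is the one for theta_int n eta a (- z) up to m |-> -m and
    the formula for theta (- z), applied to each factor. *)
Lemma theta_intN (a : int) z :
  theta_int n eta (- a) z =
  - e2pi (n%:R * z - a%:~R / n%:R) * theta_int n eta a (- z).
Proof.
rewrite /theta_int.
have -> : \prod_(0 <= m < n) theta eta (- z + m%:R / n%:R + a%:~R / n%:R * eta)
  = - e2pi (- (n%:R * (z - a%:~R / n%:R * eta))) *
    \prod_(0 <= m < n) theta eta (z + m%:R / n%:R + (- a)%:~R / n%:R * eta).
  rewrite (prod_periodic_opp
    (f := fun x => theta eta (- z + x + a%:~R / n%:R * eta))).
    rewrite -prod_theta_factor -big_split /=; apply: eq_bigr => m _.
    have -> : - z - m%:R / n%:R + a%:~R / n%:R * eta =
        - (z - a%:~R / n%:R * eta + m%:R / n%:R) by ring.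
    by rewrite rmorphN thetaN //=; congr (_ * theta eta _); ring.
  by move=> x; rewrite -[RHS]thetaD1; congr theta; ring.
rewrite [RHS]mulrA [RHS]mulrA; congr (_ * _).
rewrite mulrN !mulNr opprK -!e2piD; congr e2pi.
by rewrite !rmorphM !rmorphB !rmorphN /= -!pmulrn; field.
Qed.

End ThetaBasis.

Section ThetaResidues.
Variable R : realType.
Local Notation C := R[i].
Variable eta : C.
Hypothesis eta_gt0 : 0 < complex.Im eta.
Variable n : nat.
Hypothesis n_gt1 : (1 < n)%N.
Implicit Types (z : C) (a b : 'Z_n).

Definition chi a : C := e2pi ((a : nat)%:R / n%:R).

Lemma chiD a b : chi (a + b) = chi a * chi b.
Proof.
rewrite /chi; have -> : nat_of_ord (a + b)%R = ((a + b)%N %% n)%N.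
  by rewrite /=; congr (_ %% _)%N; exact: Zp_cast.
rewrite -e2piD -mulrDl -natrD /=.
rewrite [in RHS](divn_eq (a + b) n) natrD natrM mulrDl mulfK.
  by rewrite addrC e2piDn.
by rewrite pnatr_eq0 -lt0n ltnW.
Qed.

Lemma theta_N a z :
  theta_ eta (- a) z = - e2pi (n%:R * z) / chi a * theta_ eta a (- z).
Proof.
have n0 : (0 < n)%N by rewrite ltnW.
rewrite /chi -e2piN mulNr -e2piD.
rewrite -[X in _ = X](theta_intN eta_gt0 n0 (a : nat)%:Z z).
have Na : nat_of_ord (- a)%R = ((n - a)%N %% n)%N.
  by rewrite /=; move: (nat_of_ord a) => m; rewrite Zp_cast.
rewrite /theta_ Na.
have [->|a0] := posnP a; first by rewrite subn0 modnn oppr0.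
have lt_an : (a < n)%N by have := ltn_ord a; rewrite [X in (_ < X)%N]Zp_cast.
have -> : ((n - a) %% n = n - a)%N by rewrite modn_small // ltn_subrL a0.
rewrite -[RHS](theta_intD eta_gt0 n0).
by have -> : (n - a)%N%:Z = - (a : nat)%:Z + n%:Z by lia.
Qed.

End ThetaResidues.

(** * Reflections of the relations r_ij *)

Section CoefficientReflection.
Variable R : realType.
Local Notation C := R[i].
Variables (eta : C) (n k : nat).
Hypothesis eta_gt0 : 0 < complex.Im eta.
Hypothesis n_gt1 : (1 < n)%N.
Implicit Types (tau : C) (d r : 'Z_n).

Definition r_coef d r tau : C :=
  theta_ eta (d + (k%:R - 1) * r) 0 /
  (theta_ eta (d - r) (- tau) * theta_ eta (k%:R * r) tau).

(** Each theta contributes a sign, a power of e(n tau) and a value of chi; the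
    values of chi cancel because (d - r) + kr = d + (k-1)r. *)
Lemma r_coefN d r tau : r_coef (- d) (- r) (- tau) = - r_coef d r tau.
Proof.
rewrite /r_coef.
have -> : - d + (k%:R - 1) * - r = - (d + (k%:R - 1) * r).
  by rewrite mulrN opprD.
have -> : - d - - r = - (d - r) by rewrite opprD.
rewrite [k%:R * - r]mulrN !(theta_N eta_gt0 n_gt1) oppr0 mulr0 e2pi0 !opprK.
have -> : chi R (d + (k%:R - 1) * r) = chi R (d - r) * chi R (k%:R * r).
  by rewrite -chiD //; congr chi; rewrite mulrBl mul1r addrA addrAC.
have -> : e2pi (n%:R * - tau) = (e2pi (n%:R * tau))^-1 by rewrite mulrN e2piN.
have cB0 : chi R (d - r) != 0 by exact: e2pi_neq0.
have cD0 : chi R (k%:R * r) != 0 by exact: e2pi_neq0.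
have E0 := e2pi_neq0 (n%:R * tau).
(* The theta values in the denominator may vanish, so only their inverse is
   handed to field. *)
move: (theta_ _ _ _) (theta_ _ _ _) (theta_ _ _ _) => w y x.
move: cB0 cD0 E0; move: (chi _ _) (chi _ _) (e2pi _) => c b e b0 c0 e0.
have -> : (- e / b * y) * (- e^-1 / c * w) = (b * c)^-1 * (y * w).
  by field; rewrite b0 c0 e0.
rewrite [X in _ * X]invfM invrK; move: (y * w)^-1 => v.
by field; rewrite b0 c0.
Qed.

End CoefficientReflection.

Section EntryPermutation.
Variables (K : fieldType) (m : nat) (s : 'I_m * 'I_m -> 'I_m * 'I_m).

(** On V (x) V, seen as matrices, N (x) N is perm_entries for the involution
    (a, b) |-> (-a, -b) and the flip is perm_entries for (a, b) |-> (b, a). *)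
Definition perm_entries (M : 'M[K]_m) : 'M[K]_m :=
  \matrix_(a, b) M (s (a, b)).1 (s (a, b)).2.

Fact perm_entries_linear : linear perm_entries.
Proof. by move=> c M N; apply/matrixP => a b; rewrite !mxE. Qed.

HB.instance Definition _ := GRing.isLinear.Build K 'M[K]_m 'M[K]_m _
  perm_entries perm_entries_linear.

Hypothesis sK : involutive s.

Lemma perm_entriesK : involutive perm_entries.
Proof.
by move=> M; apply/matrixP => a b; rewrite !mxE -surjective_pairing sK.
Qed.

Lemma perm_entries_delta a b :
  perm_entries (delta_mx a b) = delta_mx (s (a, b)).1 (s (a, b)).2.
Proof.
apply/matrixP => c d; rewrite !mxE; congr (_ %:R); congr nat_of_bool.
rewrite -!xpair_eqE -!surjective_pairing.
by rewrite -{1}[(a, b)]sK (inj_eq (inv_inj sK)).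
Qed.

End EntryPermutation.

Section RelationReflections.
Variable R : realType.
Local Notation C := R[i].
Variables (eta : C) (n k : nat).
Hypothesis eta_gt0 : 0 < complex.Im eta.
Hypothesis n_gt1 : (1 < n)%N.
Implicit Types (tau : C) (i j : 'Z_n).

Lemma r_E i j tau : r_ k eta i j tau =
  \sum_(r : 'Z_n) r_coef eta k (j - i) r tau *: delta_mx (j - r) (i + r).
Proof.
apply: eq_bigr => r _; congr (_ *: _).
by rewrite /tens /x_ trmx_delta mul_delta_mx.
Qed.

Definition opp_pair (p : 'Z_n * 'Z_n) := (- p.1, - p.2).

Lemma opp_pairK : involutive opp_pair.
Proof. by move=> [a b]; rewrite /opp_pair /= !opprK. Qed.

Definition flip_pair (p : 'Z_n * 'Z_n) := (p.2, p.1).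

Lemma flip_pairK : involutive flip_pair.
Proof. by case. Qed.

Lemma r_opp_pair i j tau : perm_entries opp_pair (r_ k eta i j tau) =
  - r_ k eta (opp_pair (i, j)).1 (opp_pair (i, j)).2 (- tau).
Proof.
rewrite !r_E linear_sum -sumrN [RHS](reindex_inj oppr_inj) /=.
apply: eq_bigr => r _; rewrite linearZ /= (perm_entries_delta _ opp_pairK) /=.
rewrite -[- j - - i]opprD r_coefN // scaleNr opprK.
by congr (_ *: delta_mx _ _); rewrite opprD.
Qed.

Lemma r_flip_pair i j tau : perm_entries flip_pair (r_ k eta i j tau) =
  - r_ k eta (flip_pair (i, j)).1 (flip_pair (i, j)).2 (- tau).
Proof.
rewrite !r_E linear_sum -sumrN [RHS](reindex_inj oppr_inj) /=.
apply: eq_bigr => r _; rewrite linearZ /= (perm_entries_delta _ flip_pairK) /=.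
by rewrite -[i - j]opprB r_coefN // scaleNr !opprK.
Qed.

End RelationReflections.

(** * Uniqueness of morphisms to a projective space *)

Section ProjectiveMaps.
Local Open Scope classical_set_scope.
Variable R : realType.
Local Notation C := R[i].
Variable eta : C.
Hypothesis eta_gt0 : 0 < complex.Im eta.

(** The set (1/n) Lambda has a dense complement: for a small real t > 0, at most
    one of z0 + t and z0 + 2t belongs to it, because their difference t would
    otherwise be a real point of (1/n) Lambda, hence a multiple of 1/n. *)
Lemma near_off_div_lattice n (z0 : C) (P : C -> Prop) : (0 < n)%N ->
  (\forall z \near (z0 : C^o), P z) -> exists z, P z /\ ~ div_lattice n eta z.
Proof.
move=> n0 /nbhs_ballP[/= e e0 zP].
pose t := Num.min (complex.Re e / 4) (n%:R^-1 / 2).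
have er : e = (complex.Re e)%:C%C by rewrite RRe_real // gtr0_real.
have e0' : 0 < complex.Re e by rewrite -ltcR -er.
have t0 : 0 < t by rewrite lt_min !divr_gt0 ?invr_gt0 ?ltr0n.
have t_e : t * 2 < complex.Re e.
  have : t <= complex.Re e / 4 by rewrite ge_min lexx.
  lra.
have t_n : t < n%:R^-1.
  have : t <= n%:R^-1 / 2 by rewrite ge_min lexx orbT.
  have : 0 < n%:R^-1 :> R by rewrite invr_gt0 ltr0n.
  lra.
have Pz s : 0 < s -> s <= t * 2 -> P (z0 + s%:C%C).
  move=> s0 st; apply: zP; rewrite /ball /= opprD addrA subrr add0r normrN er.
  rewrite normc_def /= expr0n addr0 sqrtr_sqr ltcR gtr0_norm //.
  exact: le_lt_trans t_e.
have nC0 : n%:R != 0 :> C by rewrite pnatr_eq0 -lt0n.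
have [[w wL zw]|z1] := pselect (div_lattice n eta (z0 + t%:C%C)); last first.
  by exists (z0 + t%:C%C); split=> //; apply: Pz => //; lra.
have [[w2 w2L zw2]|z2] :=
  pselect (div_lattice n eta (z0 + (t * 2)%:C%C)); last first.
  by exists (z0 + (t * 2)%:C%C); split=> //; apply: Pz => //; lra.
have : w2 - w \in lattice eta by rewrite rpredB.
rewrite unfold_in => /asboolP[a [b wE]].
have tE : (n%:R * t)%:C%C = a%:~R%:C%C + b%:~R%:C%C * eta :> C.
  rewrite !rmorph_int -wE; apply: (mulfI (invr_neq0 nC0)).
  rewrite mulrBr ![_^-1 * _]mulrC.
  rewrite -zw -zw2 rmorphM rmorph_nat mulrAC divff // mul1r rmorphM /=.
  by rewrite rmorph_nat; ring.
case: (eta) eta_gt0 tE => e1 e2 /= e2_gt0 [].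
rewrite !mul0r subr0 addr0 add0r => tE1 /esym/eqP.
rewrite mulf_eq0 (gt_eqF e2_gt0) orbF intr_eq0 => /eqP b0.
move: tE1; rewrite b0 mul0r addr0 => tE1.
have : 0 < (a%:~R : R) < 1.
  by rewrite -tE1 mulr_gt0 ?ltr0n //= mulrC -ltr_pdivlMr ?ltr0n // div1r.
by rewrite ltr0z ltrz1; lia.
Qed.

Lemma eq_vline_minors (F : fieldType) p q (f g : 'M[F]_(p, q)) :
  f != 0 -> g != 0 -> (forall a b c d, f a b * g c d = f c d * g a b) ->
  <[f]>%VS = <[g]>%VS.
Proof.
move=> f0 g0 fg.
have [c [d gcd]] : exists c d, g c d != 0.
  have /matrix0Pn[c [d gcd]] := g0; by exists c, d.
have fE : f = (f c d / g c d) *: g.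
  by apply/matrixP => a b; rewrite mxE mulrAC -fg mulfK.
have k0 : f c d / g c d != 0.
  by apply: contraNneq f0 => k0; rewrite fE k0 scale0r.
apply/eqP; rewrite eqEsubv -!memvE; apply/andP; split.
  by rewrite fE memvZ // memv_line.
by rewrite -[g](scalerK k0) -fE memvZ // memv_line.
Qed.

Lemma minor_vline (F : fieldType) p q (f g : 'M[F]_(p, q)) a b c d :
  <[f]>%VS = <[g]>%VS -> f a b * g c d = f c d * g a b.
Proof.
move=> fg; have : f \in <[g]>%VS by rewrite -fg memv_line.
by move=> /vlineP[l ->]; rewrite !mxE mulrAC.
Qed.

(** Near each point, both maps lift to nowhere zero continuous functions f and
    g, and the two lines agree exactly where the minors
    f_ab g_cd - f_cd g_ab vanish.  A minor that does not vanish at z0 would not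
    vanish near z0, in particular at points off (1/n) Lambda. *)
Lemma proj_morphism_eq n p q (L L' : ecurve eta -> {vspace 'M[C]_(p, q)}) :
  (0 < n)%N -> proj_morphism L -> proj_morphism L' ->
  (forall z, ~ div_lattice n eta z -> L (epi eta z) = L' (epi eta z)) ->
  L = L'.
Proof.
move=> n0 Lm L'm LL'; apply/funext => e.
have [z0 ->] : exists z0, e = epi eta z0 by exists (repr e); rewrite /epi reprK.
have [f nf] := Lm z0; have [g ng] := L'm z0.
have [f0 df Lf] := nbhs_singleton nf; have [g0 dg L'g] := nbhs_singleton ng.
rewrite Lf L'g; apply: eq_vline_minors => // a b c d.
have cf a' b' : (fun w => f w a' b' : C^o) w @[w --> (z0 : C^o)] -->
    (f z0 a' b' : C^o).
  exact/(@differentiable_continuous _ C^o C^o)/derivable1_diffP/df.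
have cg a' b' : (fun w => g w a' b' : C^o) w @[w --> (z0 : C^o)] -->
    (g z0 a' b' : C^o).
  exact/(@differentiable_continuous _ C^o C^o)/derivable1_diffP/dg.
apply/eqP; rewrite -subr_eq0; apply/negP => /negP h0.
have ch := cvgB (cvgM (cf a b) (cg c d)) (cvgM (cf c d) (cg a b)).
have ff : Filter (nbhs (z0 : C^o)) by exact: nbhs_filter.
have nh := cvgr_neq0 _ (ch ff ff ff) h0.
have [z [[[fz _ Lz] [[gz _ L'z] hz]] nz]] :=
  near_off_div_lattice n0 (filterI nf (filterI ng (nh ff))).
move/eqP: hz; apply.
suff fgz : f z a b * g z c d = f z c d * g z a b.
  by change (f z a b * g z c d - f z c d * g z a b = 0); rewrite fgz subrr.
by apply: minor_vline; rewrite -Lz -L'z LL'.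
Qed.

End ProjectiveMaps.

(** * Symmetries of the lines L_ij and of the spaces of relations *)

Section LineSymmetry.
Variable R : realType.
Local Notation C := R[i].
Variables (eta : C) (n k : nat).
Hypothesis eta_gt0 : 0 < complex.Im eta.
Hypothesis n_gt0 : (0 < n)%N.
Variable s : 'Z_n * 'Z_n -> 'Z_n * 'Z_n.
Hypothesis sK : involutive s.
Hypothesis r_sym : forall i j tau,
  perm_entries s (r_ k eta i j tau) =
  - r_ k eta (s (i, j)).1 (s (i, j)).2 (- tau).

Local Notation sigma := (linfun (@perm_entries C _ s)).

Lemma div_latticeN z : div_lattice n eta (- z) -> div_lattice n eta z.
Proof.
move=> [w wL zw]; exists (- w); first by rewrite rpredN.
by rewrite mulNr -zw opprK.
Qed.

Lemma vlineN (v : VV R n) : <[- v]>%VS = <[v]>%VS.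
Proof.
have sub (w : VV R n) : (<[- w]> <= <[w]>)%VS by rewrite -memvE memvN memv_line.
by apply/eqP; rewrite eqEsubv sub -{1}[v]opprK sub.
Qed.

Lemma epiN z : epi eta (- z) = - epi eta z.
Proof. exact: raddfN. Qed.

Lemma near_opp (z0 : C) (P : C -> Prop) :
  (\forall z \near (- z0 : C^o), P z) -> \forall z \near (z0 : C^o), P (- z).
Proof. exact: (@opp_continuous C^o z0). Qed.

Lemma derivable_compN (h : C -> C) (z : C) :
  derivable (h : C^o -> C^o) (- z) 1 ->
  derivable (fun w : C^o => h (- w) : C^o) z 1.
Proof.
move=> dh; apply/derivable1_diffP.
apply: (@differentiable_comp C C^o C^o C^o -%R h); last exact/derivable1_diffP.
exact: (@differentiableN C C^o C^o id).
Qed.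

Lemma extends_r_sym i j (L : ecurve eta -> {vspace VV R n}) :
  extends_r k i j L ->
  extends_r k (s (i, j)).1 (s (i, j)).2
    (fun e : ecurve eta => (sigma @: L (- e))%VS).
Proof.
move=> [Lm Lr]; split=> [z0|tau tauL].
  have [f nf] := Lm (- z0); exists (fun z => perm_entries s (f (- z))).
  apply: filterS (near_opp nf) => z [f0 df Lf]; split.
  - apply: contraNneq f0 => f0; rewrite -(perm_entriesK sK (f (- z))) f0.
    by rewrite linear0.
  - move=> a b.
    apply: (derivable_compN (h := fun w => perm_entries s (f w) a b)).
    rewrite (_ : (fun w => _) =
        (fun w : C^o => f w (s (a, b)).1 (s (a, b)).2 : C^o)) //.
    by apply/funext => w; rewrite mxE.
  - by rewrite -epiN Lf limg_line lfunE.
rewrite -epiN Lr => [|/div_latticeN //].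
by rewrite limg_line lfunE /= r_sym opprK vlineN.
Qed.

Lemma extends_r_unique i j (L L' : ecurve eta -> {vspace VV R n}) :
  extends_r k i j L -> extends_r k i j L' -> L = L'.
Proof.
move=> [Lm Lr] [L'm L'r]; apply: (proj_morphism_eq eta_gt0 n_gt0 Lm L'm).
by move=> z zL; rewrite Lr // L'r.
Qed.

Lemma L_unique i j (L : ecurve eta -> {vspace VV R n}) :
  extends_r k i j L -> L_ (n := n) k i j = L.
Proof.
move=> Lij; apply: (extends_r_unique _ Lij).
exact: (@xgetPex _ _ [set L | extends_r (n := n) (eta := eta) k i j L]
  (ex_intro _ L Lij)).
Qed.

(** This holds for every pair (i, j): the two sides are the unique extensions of
    the same family of lines, or no extension exists on either side. *)
Lemma L_sym i j (e : ecurve eta) :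
  L_ (n := n) k (s (i, j)).1 (s (i, j)).2 e =
  (sigma @: L_ (n := n) k i j (- e))%VS.
Proof.
have [[L Lij]|noL] :=
  pselect (exists L, extends_r (n := n) (eta := eta) k i j L).
  by rewrite (L_unique (extends_r_sym Lij)) (L_unique Lij).
(* Without an extension, L_ takes its default value 0 on both sides. *)
have noL' : ~ exists L,
    extends_r (n := n) (eta := eta) k (s (i, j)).1 (s (i, j)).2 L.
  move=> [L /extends_r_sym]; rewrite -surjective_pairing sK /= => Lij.
  by apply: noL; exists (fun e => (sigma @: L (- e))%VS).
rewrite /L_ !xgetPN ?limg0 // => L Lij; [apply: noL|apply: noL']; by exists L.
Qed.

Lemma r_nonzero_sym i j : r_nonzero k eta i j ->
  r_nonzero k eta (s (i, j)).1 (s (i, j)).2.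
Proof.
move=> [tau [tauL r0]]; exists (- tau); split; first by move=> /div_latticeN.
apply: contraNneq r0 => r0.
by rewrite -(perm_entriesK sK (r_ _ _ _ _ _)) r_sym r0 oppr0 linear0.
Qed.

Lemma rel_nk_sym tau w :
  w \in rel_nk n k eta tau -> perm_entries s w \in rel_nk n k eta (- tau).
Proof.
move=> wrel; rewrite -(lfunE (@perm_entries C _ s)) /=.
suff : (sigma @: rel_nk n k eta tau <= rel_nk n k eta (- tau))%VS.
  by move=> /subvP; apply; exact: memv_img.
rewrite /rel_nk limg_sum; apply/subv_sumP => i _; rewrite limg_sum.
apply/subv_sumP => j /asboolP ij0.
rewrite -[epi eta tau]opprK -L_sym -epiN.
apply: (sumv_sup (s (i, j)).1) => //; apply: (sumv_sup (s (i, j)).2) => //.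
exact/asboolP/r_nonzero_sym.
Qed.

End LineSymmetry.

Section RelationSpaceReflections.
Variable R : realType.
Local Notation C := R[i].
Variables (eta : C) (n k : nat).
Hypothesis eta_gt0 : 0 < complex.Im eta.
Hypothesis n_gt1 : (1 < n)%N.
Implicit Types tau : C.

Let n_gt0 : (0 < n)%N. Proof. exact: ltnW. Qed.

Lemma rel_nk_opp tau w : w \in rel_nk n k eta tau ->
  perm_entries (@opp_pair n) w \in rel_nk n k eta (- tau).
Proof.
exact: (rel_nk_sym eta_gt0 n_gt0 (@opp_pairK n) (r_opp_pair k eta_gt0 n_gt1)).
Qed.

Lemma rel_nk_flip tau w : w \in rel_nk n k eta tau ->
  perm_entries (@flip_pair n) w \in rel_nk n k eta (- tau).
Proof.
exact: (rel_nk_sym eta_gt0 n_gt0 (@flip_pairK n)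
  (r_flip_pair k eta_gt0 n_gt1)).
Qed.

End RelationSpaceReflections.

(** * Morphisms of algebras, free algebras and quotients *)

Section AlgebraMorphisms.
Variable F : comNzRingType.
Implicit Types (A B D : algType F).

Lemma lrmorphism_of A B (h : A -> B) :
  zmod_morphism h -> monoid_morphism h -> scalable h ->
  exists f : {lrmorphism A -> B}, f =1 h.
Proof.
move=> hB hM hZ.
pose hb := GRing.isZmodMorphism.Build A B h hB.
pose hm := GRing.isMonoidMorphism.Build A B h hM.
pose hz := GRing.isScalable.Build F A B *:%R h hZ.
pose f : {lrmorphism A -> B} := HB.pack h hb hm hz.
by exists f.
Qed.

Lemma lrmorphism_inv A B (f : {lrmorphism A -> B}) (g : B -> A) :
  cancel f g -> cancel g f -> exists h : {lrmorphism B -> A}, h =1 g.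
Proof.
move=> fK gK; apply: lrmorphism_of.
- by move=> x y; apply: (can_inj fK); rewrite rmorphB /= !gK.
- split; first by apply: (can_inj fK); rewrite rmorph1 gK.
  by move=> x y; apply: (can_inj fK); rewrite rmorphM /= !gK.
- by move=> c x; apply: (can_inj fK); rewrite linearZ /= !gK.
Qed.

(** A morphism A -> B^op is the same function as a morphism A^op -> B; the
    latter form can be composed with morphisms into A^op. *)
Lemma lrmorphism_converse A B (f : {lrmorphism A -> B^c}) :
  exists h : {lrmorphism A^c -> B}, forall x : A, h x = f x.
Proof.
apply: (@lrmorphism_of A^c B f).
- exact: (raddfB f).
- by split=> [|x y]; [exact: (rmorph1 f)|exact: (rmorphM f y x)].
- by move=> c x; exact: (linearZ_LR f c x).
Qed.

(** The flip of V (x) V is what turns a quadratic relation between the g a into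
    the same relation in the opposite algebra. *)
Lemma converse_bilinear_sum A (I : finType) (w : I -> I -> F) (g : I -> A^c) :
  \sum_a \sum_b w a b *: (g a * g b) =
  \sum_a \sum_b w b a *: ((g a : A) * g b) :> A.
Proof. by rewrite [LHS]exchange_big. Qed.

Lemma extends_to_alg_iso_comp (V : Type) A B D (iA : V -> A) (iB : V -> B)
    (iD : V -> D) (g h : V -> V) :
  extends_to_alg_iso iA iB g -> extends_to_alg_iso iB iD h ->
  extends_to_alg_iso iA iD (h \o g).
Proof.
move=> [f [f_bij fg]] [f' [f'_bij f'h]]; exists (f' \o f).
by split=> [|v]; [exact: bij_comp|rewrite /= fg f'h].
Qed.

Lemma extends_to_alg_iso_inv (V : Type) A B (iA : V -> A) (iB : V -> B)
    (g : V -> V) : involutive g ->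
  extends_to_alg_iso iA iB g -> extends_to_alg_iso iB iA g.
Proof.
move=> gK [f [[f' fK f'K] fg]]; have [h hE] := lrmorphism_inv fK f'K.
exists h; split=> [|v]; first by exists f => x; rewrite hE.
by rewrite hE -{1}[v]gK -fg fK.
Qed.

End AlgebraMorphisms.

Section FreeAlgebraLift.
Variables (F : comNzRingType) (I : choiceType).

(** Two linear maps on the free algebra are equal when they agree on the products
    of generators. *)
Lemma freeAlgE (p : freeAlg F I) :
  p = \sum_(m <- msupp p) mcoeff m p *: (\prod_(i <- m) fgen F i : freeAlg F I).
Proof.
rewrite {1}[p]monalgE; apply: eq_bigr => m _.
have -> : \prod_(i <- m) fgen F i = mkmalgU m 1 :> freeAlg F I.
  case: m => s; elim: s => [|i s IHs].
    by rewrite big_nil -(fmoneE I).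
  rewrite big_cons IHs [LHS](fgmulUU 1 1) mulr1; congr mkmalgU.
  by apply: val_inj; rewrite /= fmM fmU.
by apply/malgP => m'; rewrite mcoeffZ !mcoeffU mulrnAr mulr1.
Qed.

Variables (B : algType F) (g : I -> B).

Definition fmonom_eval (m : fmonom I) : B := \prod_(i <- m) g i.

Fact fmonom_eval_mmorphism : mmorphism fmonom_eval.
Proof.
split=> [m1 m2|]; rewrite /fmonom_eval; first by rewrite fmM big_cat.
by rewrite fm1 big_nil.
Qed.

HB.instance Definition _ :=
  monalg.isMultiplicative.Build (fmonom I) B fmonom_eval fmonom_eval_mmorphism.

Lemma freeAlg_lift : exists f : {lrmorphism freeAlg F I -> B},
  forall i, f (fgen F i) = g i.
Proof.
have [f fE] : exists f : {lrmorphism freeAlg F I -> B},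
    f =1 mmap (in_alg B) fmonom_eval.
  apply: lrmorphism_of.
  - exact: mmap_is_additive.
  - have [mM m1] : multiplicative (mmap (in_alg B) fmonom_eval).
      apply: commr_mmap_is_multiplicative => p m m'.
      exact: comm_alg.
    by split.
  - by move=> c p; rewrite mmapZ /= mulr_algl.
exists f => i; rewrite fE /fgen mmapU /= scale1r mul1r /fmonom_eval fmU.
by rewrite big_seq1.
Qed.

End FreeAlgebraLift.

Section QuotientLift.
Variables (F : comNzRingType) (A : algType F) (J : properIdeal A).

HB.instance Definition _ := GRing.isZmodMorphism.Build A (quotAlg J)
  (quot_pi J) (raddfB \pi_({ideal_quot (ideal_pred J)})%qT).
HB.instance Definition _ := GRing.isMonoidMorphism.Build A (quotAlg J)
  (quot_pi J) (conj erefl (fun a b => esym (quot_piM J a b))).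
HB.instance Definition _ := GRing.isScalable.Build F A (quotAlg J) *:%R
  (quot_pi J) (fun c a => esym (quot_piZ J c a)).

Lemma quot_pi_eq0 a : ideal_set J a -> quot_pi J a = 0.
Proof.
move=> Ja; apply/eqP; rewrite -(raddf0 (quot_pi J)) quot_piP subr0 unfold_in.
exact/asboolP.
Qed.

Lemma quot_lift (B : algType F) (f : {lrmorphism A -> B}) :
  (forall a, ideal_set J a -> f a = 0) ->
  exists h : {lrmorphism quotAlg J -> B}, forall a, h (quot_pi J a) = f a.
Proof.
move=> fJ; pose h (x : quotAlg J) := f (quot_repr x).
have hE a : h (quot_pi J a) = f a.
  apply/eqP; rewrite -subr_eq0 -rmorphB; apply/eqP/fJ.
  by have := quot_repr_pi J a; rewrite unfold_in => /asboolP.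
have [g gE] : exists g : {lrmorphism quotAlg J -> B}, g =1 h.
  apply: lrmorphism_of.
  - elim/quot_ind => a; elim/quot_ind => b.
    by rewrite -(raddfB (quot_pi J)) !hE rmorphB.
  - split; first by rewrite -(rmorph1 (quot_pi J)) hE rmorph1.
    elim/quot_ind => a; elim/quot_ind => b.
    by rewrite -(rmorphM (quot_pi J)) !hE rmorphM.
  - move=> c; elim/quot_ind => a.
    by rewrite -(linearZZ (quot_pi J)) !hE linearZZ.
by exists g => a; rewrite gE.
Qed.

End QuotientLift.

(** * The algebras Q(tau) *)

Section QuotientOfTensorAlgebra.
Variable R : realType.
Local Notation C := R[i].
Variables (n k : nat) (eta : C).
Implicit Types (tau : C) (B : algType C).
Local Notation Q := (Qalg n k eta).
Local Notation y tau a := (Qgen n k eta tau (x_ R a)).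

Lemma TV1_x (a : 'Z_n) : TV1 (x_ R a) = fgen C a :> freeAlg C 'Z_n.
Proof.
rewrite /TV1 (bigD1 a) //= big1 ?addr0 => [|b ba]; rewrite /x_ mxE.
  by rewrite !eqxx scale1r.
by rewrite (negPf ba) andbF scale0r.
Qed.

Lemma QgenE tau v : Qgen n k eta tau v = \sum_(a : 'Z_n) v 0 a *: y tau a.
Proof.
rewrite /Qgen {1}/TV1 linear_sum; apply: eq_bigr => a _.
by rewrite linearZ /= TV1_x.
Qed.

Lemma Qgen_rel tau w : w \in rel_nk n k eta tau ->
  \sum_(a : 'Z_n) \sum_(b : 'Z_n) w a b *: (y tau a * y tau b) = 0.
Proof.
move=> wrel.
have w0 : quot_pi (rel_ideal n k eta tau) (TV2 w) = 0.
  apply: quot_pi_eq0; exists [:: (1, TV2 w, 1)].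
  split=> [t|]; last by rewrite big_seq1 mul1r mulr1.
  by rewrite inE => /eqP -> /=; exists w.
rewrite -[RHS]w0 /TV2 raddf_sum; apply: eq_bigr => a _.
rewrite raddf_sum; apply: eq_bigr => b _.
by rewrite /= linearZ /= rmorphM /Qgen !TV1_x.
Qed.

(** The universal property of Q = TV / (rel): it suffices to give the images of
    the x_a and to check the quadratic relations. *)
Lemma Qalg_lift B tau (g : 'Z_n -> B) :
  (forall w, w \in rel_nk n k eta tau ->
     \sum_(a : 'Z_n) \sum_(b : 'Z_n) w a b *: (g a * g b) = 0) ->
  exists f : {lrmorphism Q tau -> B},
    forall v, f (Qgen n k eta tau v) = \sum_(a : 'Z_n) v 0 a *: g a.
Proof.
move=> g0; have [f fE] := freeAlg_lift g.
have [_ [s [sJ ->]]|h hE] := @quot_lift _ _ (rel_ideal n k eta tau) B f.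
  rewrite linear_sum big_seq big1 // => t /sJ[w wrel wt].
  have fw : f (TV2 w) = 0.
    rewrite -[RHS](g0 w wrel) /TV2 linear_sum; apply: eq_bigr => a _.
    rewrite linear_sum; apply: eq_bigr => b _.
    by rewrite linearZ rmorphM /= !fE.
  by rewrite /= !rmorphM /= -wt fw mulr0 mul0r.
exists h => v; rewrite hE /TV1 linear_sum; apply: eq_bigr => a _.
by rewrite linearZ /= fE.
Qed.

Lemma Qalg_ext B tau (f g : {lrmorphism Q tau -> B}) :
  (forall v, f (Qgen n k eta tau v) = g (Qgen n k eta tau v)) -> f =1 g.
Proof.
move=> fg; elim/quot_ind => p; rewrite [p]freeAlgE !linear_sum.
apply: eq_bigr => m _; rewrite !linearZ !rmorph_prod /=; congr (_ *: _).
by apply: eq_bigr => a _; rewrite -TV1_x; exact: fg.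
Qed.

End QuotientOfTensorAlgebra.

Section QuotientIsomorphisms.
Variable R : realType.
Local Notation C := R[i].
Variables (n k : nat) (eta : C).
Hypothesis eta_gt0 : 0 < complex.Im eta.
Hypothesis n_gt1 : (1 < n)%N.
Implicit Types tau : C.
Local Notation Q := (Qalg n k eta).
Local Notation q := (Qgen n k eta).

Lemma Nmap_coord (v : Vn R n) b : Nmap n v 0 b = v 0 (- b).
Proof.
rewrite /Nmap summxE (bigD1 (- b)) //= big1 ?addr0 => [|a ab].
  by rewrite !mxE opprK !eqxx mulr1.
by rewrite !mxE -eqr_oppLR eq_sym (negPf ab) andbF mulr0.
Qed.

(** tau' stands for -tau, so that the lemma can be used in both directions: the
    algebras at tau and at -(-tau) are equal but not convertible. *)
Lemma Qalg_Nmap_hom tau tau' : tau' = - tau ->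
  exists f : {lrmorphism Q tau -> Q tau'},
    forall v, f (q tau v) = q tau' (Nmap n v).
Proof.
move=> tauE; have [w wrel|f fE] :=
    Qalg_lift (n := n) (k := k) (eta := eta) (tau := tau)
      (g := fun a => q tau' (x_ R (- a))).
  have := rel_nk_opp eta_gt0 n_gt1 wrel; rewrite -tauE => /Qgen_rel w0.
  rewrite -[RHS]w0 [RHS](reindex_inj oppr_inj); apply: eq_bigr => a _.
  rewrite [RHS](reindex_inj oppr_inj); apply: eq_bigr => b _.
  by rewrite mxE /= !opprK.
exists f => v; rewrite fE QgenE [RHS](reindex_inj oppr_inj).
by apply: eq_bigr => a _; rewrite Nmap_coord opprK.
Qed.

Lemma Qalg_converse_hom tau tau' : tau' = - tau ->
  exists f : {lrmorphism Q tau -> (Q tau')^c},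
    forall v, f (q tau v) = q tau' v.
Proof.
move=> tauE; have [w wrel|f fE] :=
    Qalg_lift (n := n) (k := k) (eta := eta) (tau := tau)
      (B := (Q tau')^c) (g := fun a => q tau' (x_ R a)).
  have := rel_nk_flip eta_gt0 n_gt1 wrel; rewrite -tauE => /Qgen_rel w0.
  apply: etrans (converse_bilinear_sum w (fun a => q tau' (x_ R a))) _.
  rewrite -[RHS]w0; apply: eq_bigr => a _.
  by apply: eq_bigr => b _; rewrite mxE.
by exists f => v; rewrite fE [RHS]QgenE.
Qed.

Lemma Qalg_Nmap_iso tau tau' : tau' = - tau ->
  extends_to_alg_iso (q tau) (q tau') (Nmap n).
Proof.
move=> tauE; have [f fE] := Qalg_Nmap_hom tauE.
have [g gE] : exists g : {lrmorphism Q tau' -> Q tau}, forall v,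
    g (q tau' v) = q tau (Nmap n v).
  by apply: Qalg_Nmap_hom; rewrite tauE opprK.
exists f; split=> //; exists g.
- by apply: (Qalg_ext (f := g \o f) (g := idfun)) => v /=; rewrite fE gE NmapK.
- by apply: (Qalg_ext (f := f \o g) (g := idfun)) => v /=; rewrite gE fE NmapK.
Qed.

Lemma Qalg_converse_iso tau tau' : tau' = - tau ->
  extends_to_alg_iso (B := (Q tau')^c) (q tau) (q tau') id.
Proof.
move=> tauE; have [f fE] := Qalg_converse_hom tauE.
have [g gE] : exists g : {lrmorphism Q tau' -> (Q tau)^c}, forall v,
    g (q tau' v) = q tau v.
  by apply: Qalg_converse_hom; rewrite tauE opprK.
have [f' f'E] := lrmorphism_converse f; have [g' g'E] := lrmorphism_converse g.
exists f; split=> //; exists g'.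
- apply: (Qalg_ext (f := g' \o f) (g := idfun)) => v /=.
  by rewrite fE g'E gE.
- move=> x; rewrite -[LHS]f'E g'E.
  apply: (Qalg_ext (f := f' \o g) (g := idfun)) => v /=.
  by rewrite gE f'E fE.
Qed.

End QuotientIsomorphisms.

Theorem proposition3p22 (R : realType) (eta : R[i]) (n k : nat)
    (eta_gt0 : 0 < complex.Im eta)
    (k_ge1 : (1 <= k)%N) (lt_k_n : (k < n)%N) (co_n_k : coprime n k)
    (tau : R[i]) :
  [/\ extends_to_alg_iso
        (Qgen n k eta tau) (Qgen n k eta (- tau)) (Nmap n),
      extends_to_alg_iso (B := (Qalg n k eta tau)^c)
        (Qgen n k eta tau) (Qgen n k eta tau) (Nmap n),
      alg_iso (Qalg n k eta tau) (Qalg n k eta tau)^c &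
      extends_to_alg_iso (A := (Qalg n k eta tau)^c)
        (Qgen n k eta tau) (Qgen n k eta (- tau)) id].
Proof.
have n_gt1 : (1 < n)%N := leq_ltn_trans k_ge1 lt_k_n.
have Niso := Qalg_Nmap_iso k eta_gt0 n_gt1 (erefl (- tau)).
have op_iso : extends_to_alg_iso (B := (Qalg n k eta tau)^c)
    (Qgen n k eta (- tau)) (Qgen n k eta tau) id.
  by apply: Qalg_converse_iso; rewrite ?opprK.
have Nop := extends_to_alg_iso_comp Niso op_iso.
split; [exact: Niso|exact: Nop| |].
  by have [f [f_bij _]] := Nop; exists f.
exact: (extends_to_alg_iso_inv (fun=> erefl) op_iso).
Qed.
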